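(* Let $P_m,P_n$ be two path graphs with $m\ge n\ge 2$. If $n=2$, then $\delta(P_m\times P_2)=0$. If $n\ge 3$, then $$\min\Big\{\frac{m}{2},\,n-1\Big\}-1\le\delta(P_m\times P_n)\le\min\Big\{\frac{m}{2},\,n\Big\}-\frac12.$$ Furthermore, if $m\le 2n-3$ and $m$ is odd, then $\delta(P_m\times P_n)=(m-1)/2$.
   Context: $P_n$ denotes the path graph with $n$ vertices. Every edge of a graph has length $1$, and a connected graph is regarded as a geodesic metric space by identifying each edge isometrically with $[0,1]$ and using the shortest-path distance (so its points are vertices and interior points of edges). Direct product: $G_1\times G_2$ has vertex set $V(G_1)\times V(G_2)$, and $(u_1,v_1)$, $(u_2,v_2)$ are adjacent iff $[u_1,u_2]\in E(G_1)$ and $[v_1,v_2]\in E(G_2)$. It may be disconnected. Hyperbolicity constant: in a geodesic metric space $X$, a geodesic triangle is the union of three geodesics $[x_1x_2],[x_2x_3],[x_3x_1]$; it is $\delta$-thin if each side is contained in the $\delta$-neighborhood of the union of the other two sides. $\delta(T)$ is the infimum of $\delta\ge 0$ such that $T$ is $\delta$-thin, and $\delta(X):=\sup_T\delta(T)$ over all geodesic triangles $T$ in $X$. If $X$ has connected components $X_i$, then $\delta(X):=\sup_i\delta(X_i)$. *)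

(* Defs.v *)
From HB Require Import structures.
From mathcomp Require Import all_boot all_order all_algebra.
From mathcomp Require Import all_classical all_reals all_analysis.

Set Implicit Arguments.
Unset Strict Implicit.
Unset Printing Implicit Defensive.

Import Order.TTheory GRing.Theory Num.Theory.

Local Open Scope classical_set_scope.
Local Open Scope ring_scope.

(* The distance d is extended-real-valued: points in different connected
   components of a graph are at distance +oo. A is the carrier of the space. *)
Section GeodesicTriangles.
Variables (R : realType) (X : Type) (d : X -> X -> \bar R).

Definition is_geodesic (A : set X) (x y : X) (S : set X) : Prop :=
  exists (L : R) (g : R -> X),
    [/\ 0 <= L,
        g 0 = x /\ g L = y,
        forall t, 0 <= t <= L -> A (g t),
        forall s t, 0 <= s <= L -> 0 <= t <= L -> d (g s) (g t) = `|s - t|%:E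
      & S = [set g t | t in [set t | 0 <= t <= L]]].

Definition nbhd_of (delta : R) (S : set X) : set X :=
  [set p | exists2 q, S q & (d p q <= delta%:E)%E].

Definition thin (delta : R) (S1 S2 S3 : set X) : Prop :=
  [/\ S1 `<=` nbhd_of delta (S2 `|` S3),
      S2 `<=` nbhd_of delta (S3 `|` S1)
    & S3 `<=` nbhd_of delta (S1 `|` S2)].

Definition thin_constant (S1 S2 S3 : set X) : \bar R :=
  ereal_inf [set delta%:E | delta in [set delta | 0 <= delta
                                               /\ thin delta S1 S2 S3]].

Definition space_hyperbolicity (A : set X) : \bar R :=
  ereal_sup [set c | exists x1 x2 x3 S1 S2 S3,
    [/\ is_geodesic A x1 x2 S1, is_geodesic A x2 x3 S2,
        is_geodesic A x3 x1 S3 & c = thin_constant S1 S2 S3]].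

End GeodesicTriangles.

Record sgraph := SGraph {
  vertex :> finType;
  edge : rel vertex;
  edge_sym : symmetric edge;
  edge_irr : irreflexive edge }.

Definition path_edge (n : nat) : rel 'I_n :=
  fun i j => (i.+1 == j :> nat) || (j.+1 == i :> nat).

Lemma path_edge_sym n : symmetric (@path_edge n).
Proof. by move=> i j; rewrite /path_edge orbC. Qed.

Lemma path_edge_irr n : irreflexive (@path_edge n).
Proof. by move=> i; rewrite /path_edge eqn_leq ltnn. Qed.

Definition path_graph (n : nat) : sgraph :=
  SGraph (@path_edge_sym n) (@path_edge_irr n).

Section DirectProduct.
Variables G1 G2 : sgraph.

Definition direct_edge : rel (G1 * G2)%type :=
  fun p q => edge p.1 q.1 && edge p.2 q.2.

Lemma direct_edge_sym : symmetric direct_edge.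
Proof.
by move=> p q; rewrite /direct_edge (edge_sym p.1) (edge_sym p.2).
Qed.

Lemma direct_edge_irr : irreflexive direct_edge.
Proof. by move=> p; rewrite /direct_edge edge_irr. Qed.

Definition direct_product : sgraph := SGraph direct_edge_sym direct_edge_irr.

End DirectProduct.

(* Points of the metric graph are represented by barycentric coordinates on the
   vertices. *)
Section MetricGraph.
Variables (R : realType) (G : sgraph).

(* The point at distance t from u on the edge [u, v]; for u = v it is the
   vertex u. *)
Definition edge_point (u v : G) (t : R) : {ffun G -> R} :=
  [ffun w => (1 - t) *+ (w == u) + t *+ (w == v)].

Inductive walk_length : {ffun G -> R} -> {ffun G -> R} -> R -> Prop :=
| WalkNil x : walk_length x x 0
| WalkCons (u v : G) (s t : R) y l :
    edge u v -> 0 <= s <= 1 -> 0 <= t <= 1 ->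
    walk_length (edge_point u v t) y l ->
    walk_length (edge_point u v s) y (`|s - t| + l).

Definition graph_dist (x y : {ffun G -> R}) : \bar R :=
  ereal_inf [set l%:E | l in walk_length x y].

(* Restricting graph_dist to a component gives its own shortest-path distance,
   since a walk never leaves the component where it starts. *)
Definition component (v : G) : set {ffun G -> R} :=
  [set x | exists u w t, [/\ connect (@edge G) v u, (w == u) || edge u w,
                             0 <= t <= 1 & x = edge_point u w t]].

Definition hyperbolicity : \bar R :=
  ereal_sup [set space_hyperbolicity graph_dist (component v) | v in [set: G]].

End MetricGraph.

(* Main.v *)
Require Import Defs.
From mathcomp Require Import all_boot all_order all_algebra.
From mathcomp Require Import all_classical all_reals all_analysis.
From mathcomp Require Import ring lra zify.

(* Vertices of one component of P_m x P_n are at distance the larger of their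
   column and row gaps, and the column number extends linearly to a 1-Lipschitz
   function f on the metric graph.

   Upper bounds. Each component has diameter at most m - 1, and a point of a
   side is within half its length of an endpoint, so delta <= (m - 1) / 2. Also,
   the other two sides of a triangle join the endpoints of the first one, so f
   takes on them every value between the values at those endpoints; points with
   the same f are within n - 1 (0 if n = 2) of each other, and a side
   overshooting the f-values of its endpoints is short.

   Lower bound. If r + 2 <= n and 2r + 1 <= m, join (0, 1) to (2r, 1) by the
   geodesic climbing to row r + 1 and back, and by the one zigzagging between
   rows 0 and 1: the top of the first is at distance at least r from the second. *)

Import Order.TTheory GRing.Theory Num.Theory.
Local Open Scope ring_scope.

(** * Thin triangles in a space with an extended-real distance *)

Section Thinness.
Import numFieldNormedType.Exports.
Local Open Scope classical_set_scope.
Context {R : realType} {X : Type} {d : X -> X -> \bar R} {A : set X}.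

Lemma is_geodesic_ends {x y : X} {S : set X} :
  is_geodesic d A x y S -> S x /\ S y.
Proof.
by case=> L [g [L0 [<- <-] _ _ ->]]; split; [exists 0|exists L];
  rewrite //= lexx L0.
Qed.

Lemma is_geodesic_rev {x y : X} {S : set X} :
  is_geodesic d A x y S -> is_geodesic d A y x S.
Proof.
case=> L [g [L0 [gx gy] gA gd ->]]; exists L, (fun t => g (L - t)); split=> //.
- by rewrite subr0 subrr.
- by move=> t tL; apply: gA; lra.
- move=> s t sL tL; rewrite gd; [|lra|lra].
  by congr (_%:E); rewrite distrC; congr `|_|; ring.
- have rev_itv t : 0 <= t <= L -> 0 <= L - t <= L by lra.
  apply/seteqP; split=> p [t tL <-]; exists (L - t) => //; try exact: rev_itv.
  by rewrite opprB addrC subrK.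
Qed.

Lemma is_geodesic_point {x : X} :
  A x -> d x x = 0%:E -> is_geodesic d A x x [set x].
Proof.
move=> Ax dxx; exists 0, (fun=> x); split=> //.
- move=> s t s0 t0; rewrite dxx; congr (_%:E).
  have -> : s - t = 0 by lra.
  by rewrite normr0.
- apply/seteqP; split=> p /=; first by move=> ->; exists 0; rewrite //= lexx.
  by case=> t _ <-.
Qed.

(** Rotating a triangle permutes its three thinness conditions, so one of them, for all triangles,
    gives the others. *)
Lemma space_hyperbolicity_le (K : R) : 0 <= K ->
  (forall x y z S T U, is_geodesic d A x y S -> is_geodesic d A y z T ->
    is_geodesic d A z x U -> S `<=` nbhd_of d K (T `|` U)) ->
  (space_hyperbolicity d A <= K%:E)%E.
Proof.
move=> K0 side; apply: ge_ereal_sup => c [x [y [z [S [T [U [gS gT gU ->]]]]]]].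
apply: ereal_inf_lbound; exists K => //; split=> //.
by split; [exact: side gS gT gU|exact: side gT gU gS|exact: side gU gS gT].
Qed.

(** A bigon is a triangle whose third side is the point [y]; since [y] lies on [T], it is also far
    from [p]. *)
Lemma space_hyperbolicity_ge_bigon (r : R) {x y p : X} {S T : set X} :
  is_geodesic d A x y S -> is_geodesic d A x y T -> A y -> d y y = 0%:E ->
  S p -> (forall q, T q -> (r%:E <= d p q)%E) ->
  (r%:E <= space_hyperbolicity d A)%E.
Proof.
move=> gS gT Ay dyy Sp far.
apply: (@le_trans _ _ (thin_constant d S [set y] T)); last first.
  apply: ereal_sup_ubound; exists x, y, y, S, [set y], T; split=> //.
  - exact: is_geodesic_point.
  - exact: is_geodesic_rev.
apply: le_ereal_inf_tmp => _ [delta [_ [thinS _ _]] <-].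
have [q [->|Tq] dq] := thinS p Sp; last exact: le_trans (far q Tq) dq.
by apply: le_trans dq; apply: far; have [] := is_geodesic_ends gT.
Qed.

Lemma space_hyperbolicity_le_half_diam (D : R) : 0 <= D ->
  (forall p q, A p -> A q -> (d p q <= D%:E)%E) ->
  (space_hyperbolicity d A <= (D / 2)%:E)%E.
Proof.
move=> D0 diam; apply: space_hyperbolicity_le; first lra.
move=> x y z S T U gS gT gU.
have [Ty _] := is_geodesic_ends gT; have [_ Ux] := is_geodesic_ends gU.
case: gS => L [g [L0 [g0 gL] gA gd ->]] p [t /= /andP[t0 tL] <-].
have LD : L <= D.
  have := diam _ _ (gA 0 _) (gA L _).
  rewrite gd ?lexx ?L0 // lee_fin sub0r normrN ger0_norm //.
  by apply; lra.
have [tD|tD] := leP t (D / 2).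
- exists x; first by right.
  rewrite -g0 gd ?t0 ?tL ?lexx ?L0 // lee_fin subr0 ger0_norm //.
- exists y; first by left.
  rewrite -gL gd ?t0 ?tL ?lexx ?L0 // lee_fin distrC ger0_norm; lra.
Qed.

Context {f : X -> R}.
Hypothesis f_lip : forall p q, (`|f p - f q|%:E <= d p q)%E.

Lemma geodesic_ivt {x y : X} {S : set X} {c : R} : is_geodesic d A x y S ->
  Num.min (f x) (f y) <= c <= Num.max (f x) (f y) -> exists2 q, S q & f q = c.
Proof.
case=> L [g [L0 [g0 gL] gA gd ->]] fc.
(* [g] is controlled only on [[0, L]]; clamping the parameter gives a function 1-Lipschitz on the
   whole line. *)
pose cl t : R := Num.max 0 (Num.min t L).
have cl_bd t : 0 <= cl t <= L.
  by rewrite /cl le_max lexx /= ge_max L0 ge_min lexx orbT.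
have cl_lip s t : `|cl s - cl t| <= `|s - t|.
  rewrite /cl; case: (leP s L) => ?; case: (leP t L) => ?;
    rewrite ?(max_r L0); case: (leP 0 s) => ?; case: (leP 0 t) => ?;
    rewrite ler_norml; case: (ger0P (s - t)) => ?; lra.
have h_lip s t : `|f (g (cl s)) - f (g (cl t))| <= `|s - t|.
  apply: le_trans (cl_lip s t).
  by rewrite -lee_fin -(gd (cl s) (cl t)) //; apply: f_lip.
have h_cont : {within `[0, L], continuous (fun t => f (g (cl t)))}.
  apply: continuous_subspaceT => t; apply/cvgrPdist_le => e e0.
  near=> s; apply: le_trans (h_lip _ _) _.
  by near: s; apply: cvgr_dist_le.
have cl0 : cl 0 = 0 by rewrite /cl min_l // maxxx.
have clL : cl L = L by rewrite /cl minxx max_r.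
have [|t _ <-] := @IVT R _ 0 L c L0 h_cont; first by rewrite cl0 clL g0 gL.
by exists (g (cl t)) => //; exists (cl t) => /=.
Unshelve. all: by end_near.
Qed.

(* A point of a side either shares its f-value with a point of the other sides,
   or the side overshoots the f-values of its endpoints and is too short for
   both endpoints to be at distance more than K. *)
Lemma space_hyperbolicity_le_fiber (K : R) : 0 <= K ->
  (forall p q, A p -> A q -> f p = f q -> (d p q <= K%:E)%E) ->
  (forall p q, A p -> A q ->
    (d p q <= (Num.max (`|f p - f q| + K) (2 * K))%:E)%E) ->
  (space_hyperbolicity d A <= K%:E)%E.
Proof.
move=> K0 fib diam; apply: space_hyperbolicity_le => //.
move=> x y z S T U gS gT gU.
have [Ty _] := is_geodesic_ends gT; have [_ Ux] := is_geodesic_ends gU.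
have inA x' y' S' : is_geodesic d A x' y' S' -> S' `<=` A.
  by case=> L' [g' [_ _ g'A _ ->]] p [t tL <-]; exact: g'A.
have TA := inA _ _ _ gT; have UA := inA _ _ _ gU.
case: gS => L [g [L0 [g0 gL] gA gd ->]] p [t /= /andP[t0 tL] <-].
have Agt : A (g t) by apply: gA; rewrite t0.
have [bet|nbet] := boolP (Num.min (f x) (f y) <= f (g t) <= Num.max (f x) (f y)).
  have : Num.min (f y) (f z) <= f (g t) <= Num.max (f y) (f z) \/
         Num.min (f z) (f x) <= f (g t) <= Num.max (f z) (f x).
    move: bet; rewrite !ge_min !le_max => /andP[/orP lo /orP hi].
    have /orP[cz|zc] := le_total (f (g t)) (f z).
      by rewrite cz !orbT; case: lo => ->; [right|left]; rewrite ?orbT.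
    by rewrite zc !orbT; case: hi => ->; [right|left]; rewrite ?orbT.
  by case=> [/(geodesic_ivt gT) [q Tq]|/(geodesic_ivt gU) [q Uq]] fq; exists q;
    do ?[by left|by right]; apply: fib; rewrite // ?fq; auto.
have dx : d (g t) x = t%:E by rewrite -g0 gd ?t0 ?lexx // subr0 ger0_norm.
have dy : d (g t) y = (L - t)%:E.
  by rewrite -gL gd ?t0 ?lexx ?L0 // distrC ger0_norm // subr_ge0.
have [tK|tK] := leP t K; first by exists x; [right|rewrite dx lee_fin].
have [LtK|LtK] := leP (L - t) K; first by exists y; [left|rewrite dy lee_fin].
have fx := f_lip (g t) x; have fy := f_lip (g t) y.
have Ax : A x by exact: UA.
have Ay : A y by exact: TA.
(* Both [t] and [L - t] exceed [K], so [diam] forces [L <= |f x - f y| + K]. But overshooting makes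
   [|f x - f y|] less than the larger of [t] and [L - t], hence less than [L - K]. *)
have := diam _ _ Ax Ay; rewrite -{1}g0 -{1}gL gd ?lexx ?L0 //.
move: fx fy nbet; rewrite dx dy !lee_fin sub0r normrN (ger0_norm L0).
rewrite ge_min !le_max !ler_norml negb_and !negb_or -!ltNge.
move=> /andP[? ?] /andP[? ?] /orP[] /andP[? ?] /orP[];
  by case: (ger0P (f x - f y)) => ? ?; lra.
Qed.

End Thinness.

(** * Walks, Lipschitz functions and geodesics in a metric graph *)

Section MetricGraph.
Local Open Scope classical_set_scope.
Context {R : realType} {G : sgraph}.
Implicit Types (u v w : G) (x y z : {ffun G -> R}) (c : G -> R).

Definition graph_vertex u : {ffun G -> R} := edge_point u u 0.

Lemma edge_point0 u v : edge_point u v 0 = graph_vertex u.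
Proof. by apply/ffunP=> w; rewrite !ffunE !mul0rn. Qed.

Lemma edge_pointC u v (t : R) : edge_point u v t = edge_point v u (1 - t).
Proof. by apply/ffunP=> w; rewrite !ffunE subKr addrC. Qed.

Lemma edge_point1 u v : edge_point u v 1 = graph_vertex v.
Proof. by rewrite edge_pointC subrr edge_point0. Qed.

Lemma edge_point_id u (t : R) : edge_point u u t = graph_vertex u.
Proof. by apply/ffunP=> w; rewrite !ffunE -!mulrnDl !subrK. Qed.

Lemma walk_length_trans {x y z} {k l : R} :
  walk_length x y k -> walk_length y z l -> walk_length x z (k + l).
Proof.
move=> xy yz; elim: xy yz => [?|u v s t y' k' uv s01 t01 _ IH yz].
  by rewrite add0r.
by rewrite -addrA; apply: WalkCons => //; exact: IH.
Qed.

Lemma walk_length_edge {u v} {s t : R} : edge u v -> 0 <= s <= 1 ->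
  0 <= t <= 1 -> walk_length (edge_point u v s) (edge_point u v t) `|s - t|.
Proof.
by move=> uv s01 t01; rewrite -[`|_|]addr0; apply: WalkCons => //; exact: WalkNil.
Qed.

Lemma walk_length_sym {x y} {l : R} : walk_length x y l -> walk_length y x l.
Proof.
elim=> [?|u v s t y' k uv s01 t01 _ IH]; first exact: WalkNil.
by rewrite addrC distrC; exact/(walk_length_trans IH)/walk_length_edge.
Qed.

Lemma graph_dist_le {x y} {l b : R} :
  walk_length x y l -> l <= b -> (graph_dist x y <= b%:E)%E.
Proof.
move=> xy lb; apply: (@le_trans _ _ l%:E); last by rewrite lee_fin.
by apply: ereal_inf_lbound; exists l.
Qed.

Lemma walk_length_between {u w u' w'} {s t l : R} : edge u w -> edge u' w' ->
  0 <= s <= 1 -> 0 <= t <= 1 ->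
  walk_length (graph_vertex u) (graph_vertex u') l ->
  walk_length (edge_point u w s) (edge_point u' w' t) (s + l + t).
Proof.
move=> uw uw' s01 t01 uu'.
have i01 : 0 <= (0 : R) <= 1 by rewrite lexx ler01.
have := walk_length_edge uw s01 i01; have := walk_length_edge uw' i01 t01.
rewrite !edge_point0 subr0 sub0r normrN !ger0_norm; try by lra.
by move=> w2 w1; exact: walk_length_trans (walk_length_trans w1 uu') w2.
Qed.

(** In barycentric coordinates this weighted sum is the extension of [c] that is affine on every
    edge. *)
Definition extend c x : R := \sum_w x w * c w.

Lemma extend_edge_point c u v (t : R) :
  extend c (edge_point u v t) = (1 - t) * c u + t * c v.
Proof.
have mask w' (a : R) : \sum_w a *+ (w == w') * c w = a * c w'.
  rewrite (bigD1 w') //= eqxx big1 ?addr0 // => w /negPf ->.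
  by rewrite mul0r.
rewrite /extend; under eq_bigr do rewrite ffunE mulrDl.
by rewrite big_split /= !mask.
Qed.

Lemma extend_graph_vertex c u : extend c (graph_vertex u) = c u.
Proof. by rewrite extend_edge_point subr0 mul1r mul0r addr0. Qed.

(** Each step of a walk stays on one edge, where the extension has slope at most 1. Lower bounds on
    [graph_dist] come from here. *)
Lemma extend_lipschitz {c} : (forall u v, edge u v -> `|c u - c v| <= 1) ->
  forall x y, (`|extend c x - extend c y|%:E <= graph_dist x y)%E.
Proof.
move=> c_lip x y; apply: le_ereal_inf_tmp => _ [l xy <-]; rewrite lee_fin.
elim: xy => [?|u v s t y' k uv s01 t01 _ IH]; first by rewrite subrr normr0.
have -> : extend c (edge_point u v s) - extend c y' =
    (t - s) * (c u - c v) + (extend c (edge_point u v t) - extend c y').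
  by rewrite !extend_edge_point; ring.
apply: le_trans (ler_normD _ _) (lerD _ IH).
by rewrite normrM distrC ler_piMr // c_lip.
Qed.

Lemma graph_dist0 x : graph_dist x x = 0%:E.
Proof.
apply/le_anti/andP; split; first exact: graph_dist_le (WalkNil x) _.
(* The zero function shows that no walk has negative length. *)
have := @extend_lipschitz (fun=> 0) _ x x.
by rewrite !subrr normr0; apply=> *; rewrite ler01.
Qed.

(** At an integer parameter the next vertex has weight 0, so the value at [L] depends on [v L]
    alone. *)
Definition polyline (v : nat -> G) (t : R) : {ffun G -> R} :=
  edge_point (v (Num.truncn t)) (v (Num.truncn t).+1) (t - (Num.truncn t)%:R).

Lemma polyline_nat (v : nat -> G) k : polyline v k%:R = graph_vertex (v k).
Proof. by rewrite /polyline natrK subrr edge_point0. Qed.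

Lemma polylineE (v : nat -> G) k (t : R) : k%:R <= t <= k.+1%:R ->
  polyline v t = edge_point (v k) (v k.+1) (t - k%:R).
Proof.
move=> /andP[kt]; rewrite le_eqVlt => /orP[/eqP -> | tk].
  by rewrite polyline_nat -natrB // subSnn edge_point1.
by rewrite /polyline (@truncn_def _ t k) // kt tk.
Qed.

Lemma extend_polyline c (v : nat -> G) L (a : R) :
  (forall k, (k <= L)%N -> c (v k) = a + k%:R) ->
  forall t, 0 <= t <= L%:R -> extend c (polyline v t) = a + t.
Proof.
move=> cv t /andP[t0]; have /andP[] := truncn_itv t0.
set k := Num.truncn t => kt tk; rewrite le_eqVlt => /orP[/eqP -> | tL].
  by rewrite polyline_nat extend_graph_vertex cv.
have kL : (k < L)%N by rewrite -(ltr_nat R); exact: le_lt_trans tL.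
by rewrite extend_edge_point !cv ?(ltnW kL) // -natr1; ring.
Qed.

Lemma extend_polyline_le c (v : nat -> G) L (b : R) :
  (forall k, (k <= L)%N -> c (v k) <= b) ->
  forall t, 0 <= t <= L%:R -> extend c (polyline v t) <= b.
Proof.
move=> cv t /andP[t0]; have /andP[] := truncn_itv t0.
set k := Num.truncn t => kt tk; rewrite le_eqVlt => /orP[/eqP -> | tL].
  by rewrite polyline_nat extend_graph_vertex cv.
have kL : (k < L)%N by rewrite -(ltr_nat R); exact: le_lt_trans tL.
rewrite extend_edge_point; move: (cv _ (ltnW kL)) (cv _ kL) tk.
rewrite -/k -natr1 => c1 c2 tk.
have := ler_wpM2l (_ : 0 <= 1 - (t - k%:R)) c1.
have := ler_wpM2l (_ : 0 <= t - k%:R) c2.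
by move=> /(_ ltac:(lra)) ? /(_ ltac:(lra)) ?; lra.
Qed.

Lemma walk_length_polyline (v : nat -> G) L :
  (forall k, (k < L)%N -> edge (v k) (v k.+1)) ->
  forall s t, 0 <= s -> s <= t -> t <= L%:R ->
  walk_length (polyline v s) (polyline v t) (t - s).
Proof.
elim: L => [_ s t s0 st tL|L IH ev s t s0 st tL].
  by have [-> ->] : s = 0 /\ t = 0 by [lra]; rewrite subrr; exact: WalkNil.
have {}IH := IH (fun k kL => ev k (leqW kL)).
have [tL'|/ltW tL'] := leP t L%:R; first exact: IH.
have edge_walk s' : L%:R <= s' -> s' <= t ->
    walk_length (polyline v s') (polyline v t) (t - s').
  move=> Ls' s't; rewrite !(@polylineE v L); do ?[by lra].
  have -> : t - s' = `|(s' - L%:R) - (t - L%:R)|.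
    by rewrite distrC ger0_norm; lra.
  by move: tL; rewrite -natr1 => tL; apply: walk_length_edge; [exact: ev|lra|lra].
have [sL|/ltW sL] := leP L%:R s; first exact: edge_walk.
have -> : t - s = (L%:R - s) + (t - L%:R) by ring.
by apply: walk_length_trans (IH _ _ _ _ _) (edge_walk _ _ _).
Qed.

(** The 1-Lipschitz extension of [c] grows at unit speed along the polyline, so no walk between two
    of its points is shorter. *)
Lemma polyline_geodesic (v : nat -> G) L c (a : R) :
  (forall k, (k < L)%N -> edge (v k) (v k.+1)) ->
  (forall u w, edge u w -> `|c u - c w| <= 1) ->
  (forall k, (k <= L)%N -> c (v k) = a + k%:R) ->
  is_geodesic (@graph_dist R G) (component (v 0%N))
    (graph_vertex (v 0%N)) (graph_vertex (v L))
    [set polyline v t | t in [set t | 0 <= t <= L%:R]].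
Proof.
move=> ev c_lip cv; exists L%:R, (polyline v); split=> //.
- by rewrite (polyline_nat v 0) polyline_nat.
- have conn k : (k <= L)%N -> connect (@edge G) (v 0%N) (v k).
    elim: k => // k IH kL; apply: connect_trans (IH (ltnW kL)) (connect1 _).
    exact: ev.
  move=> t /andP[t0]; have /andP[] := truncn_itv t0.
  set k := Num.truncn t => kt tk; rewrite le_eqVlt => /orP[/eqP -> | tL].
    exists (v L), (v L), 0; rewrite eqxx lexx ler01 polyline_nat.
    by split=> //; exact: conn.
  have kL : (k < L)%N by rewrite -(ltr_nat R); exact: le_lt_trans tL.
  exists (v k), (v k.+1), (t - k%:R); split=> //.
  + exact/conn/ltnW.
  + by rewrite ev ?orbT.
  + by move: tk; rewrite -natr1; lra.
- move=> s t s0L t0L; apply/le_anti/andP; split.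
    have [st|/ltW ts] := leP s t.
      rewrite distrC ger0_norm ?subr_ge0 //.
      by apply: (graph_dist_le (walk_length_polyline _ _ ev s t _ st _)); lra.
    rewrite ger0_norm ?subr_ge0 //.
    by apply/(graph_dist_le (walk_length_sym
      (walk_length_polyline _ _ ev t s _ ts _))); lra.
  have := extend_lipschitz c_lip (polyline v s) (polyline v t).
  by rewrite !(extend_polyline _ _ _ _ cv) // [X in `|X|](_ : _ = s - t) //; ring.
Qed.

End MetricGraph.

(** * Distances in the components of the direct product of two paths *)

Section Grid.
Context {m n : nat}.
Notation grid := (direct_product (path_graph m) (path_graph n)).
Implicit Types u v w : grid.

Definition col u : nat := nat_of_ord (u.1 : 'I_m).
Definition row u : nat := nat_of_ord (u.2 : 'I_n).

Lemma grid_edgeE u v : edge u v =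
  (((col u).+1 == col v) || ((col v).+1 == col u)) &&
  (((row u).+1 == row v) || ((row v).+1 == row u)).
Proof. by []. Qed.

Lemma col_lt u : (col u < m)%N. Proof. exact: ltn_ord. Qed.

Lemma row_lt u : (row u < n)%N. Proof. exact: ltn_ord. Qed.

Lemma grid_inj u v : col u = col v -> row u = row v -> u = v.
Proof. by case: u v => [i j] [i' j']; rewrite /col /row /= => /ord_inj-> /ord_inj->. Qed.

Lemma grid_vertexP i j : (i < m)%N -> (j < n)%N ->
  exists u, col u = i /\ row u = j.
Proof. by move=> im jn; exists (Ordinal im, Ordinal jn). Qed.

(** An edge changes both the column and the row by one, which preserves the parity of their sum. *)
Lemma connect_parity u v :
  connect (@edge grid) u v -> odd (col u + row u) = odd (col v + row v).
Proof.
have parity_closed : fingraph.closed (@edge grid)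
    [pred w | odd (col w + row w)].
  by move=> w w'; rewrite !inE grid_edgeE; lia.
by move/(closed_connect parity_closed); rewrite !inE.
Qed.

(** In a direct product each coordinate has to move at every step: toward [b] if it differs from
    [b], otherwise one away, which is harmless when [D] is positive. *)
Lemma neighbour_toward k a b : (1 < k)%N -> (a < k)%N -> (b < k)%N ->
  exists2 a', (a' < k)%N && ((a.+1 == a') || (a'.+1 == a)) &
    forall D, (a == b -> 0 < D)%N -> (a <= b + D.+1)%N -> (b <= a + D.+1)%N ->
      (a' <= b + D)%N /\ (b <= a' + D)%N.
Proof.
move=> k1 ak bk; have [ab|ba|ab] := ltngtP a b.
- by exists a.+1 => [|D]; lia.
- by exists a.-1 => [|D]; lia.
- by exists (if a.+1 < k then a.+1 else a.-1)%N => [|D]; case: ifP; lia.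
Qed.

Definition within D u v :=
  [&& col u <= col v + D, col v <= col u + D,
      row u <= row v + D & row v <= row u + D]%N.

Context {R : realType}.
Implicit Types x p q : {ffun grid -> R}.
Hypotheses (m_gt1 : (1 < m)%N) (n_gt1 : (1 < n)%N).

(** Both coordinates approach [v] simultaneously, so each edge lowers the admissible gap by one. *)
Lemma walk_length_grid D u v :
  odd (col u + row u) = odd (col v + row v) -> within D u v ->
  exists2 l : R, walk_length (graph_vertex u) (graph_vertex v) l & l <= D%:R.
Proof.
elim: D u => [|D IH] u par /and4P[c1 c2 r1 r2].
  have -> : u = v by apply: grid_inj; lia.
  by exists 0; [exact: WalkNil|].
have [c /andP[cm uc] cD] := neighbour_toward _ _ _ m_gt1 (col_lt u) (col_lt v).
have [r /andP[rn ur] rD] := neighbour_toward _ _ _ n_gt1 (row_lt u) (row_lt v).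
have [->|uv] := eqVneq u v; first by exists 0; [exact: WalkNil|rewrite ler0n].
have [w [wc wr]] := grid_vertexP _ _ cm rn.
have ne : (col u == col v) && (row u == row v) = false.
  by apply: contraNF uv => /andP[/eqP ? /eqP ?]; apply/eqP/grid_inj.
have uw : edge u w by rewrite grid_edgeE wc wr uc ur.
(* If one coordinate already agrees, parity makes the gap in the other even and nonzero, hence at
   least 2. *)
have D0 : (col u == col v) || (row u == row v) -> (0 < D)%N by lia.
have [? ?] := cD D ltac:(lia) c1 c2; have [? ?] := rD D ltac:(lia) r1 r2.
have [||l wv lD] := IH w; [lia|by apply/and4P; split; lia|].
exists (1 + l); last by rewrite -natr1 addrC lerD.
apply: walk_length_trans wv.
have := @walk_length_edge R _ u w 0 1 uw.
by rewrite edge_point0 edge_point1 sub0r normrN normr1; apply; lra.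
Qed.

Definition colR u : R := (col u)%:R.
Definition rowR u : R := (row u)%:R.

Let adjacent_nat_dist a b : (a.+1 == b) || (b.+1 == a) ->
  `|a%:R - b%:R| <= 1 :> R.
Proof. by move=> /orP[] /eqP <-; rewrite -natr1 ler_norml; lra. Qed.

Lemma colR_lipschitz u v : edge u v -> `|colR u - colR v| <= 1.
Proof. by rewrite grid_edgeE => /andP[/adjacent_nat_dist]. Qed.

Lemma rowR_lipschitz u v : edge u v -> `|rowR u - rowR v| <= 1.
Proof. by rewrite grid_edgeE => /andP[_ /adjacent_nat_dist]. Qed.

(** Every edge joins consecutive columns, so it can be read from left to right; a bare vertex is an
    end of some edge because both paths have at least two vertices. *)
Lemma component_gridP v x : component v x -> exists u w (t : R),
  [/\ edge u w, col w = (col u).+1, odd (col u + row u) = odd (col v + row v),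
      0 <= t <= 1 & x = edge_point u w t].
Proof.
have orient u w (t : R) : edge u w ->
    odd (col u + row u) = odd (col v + row v) -> 0 <= t <= 1 ->
    exists u' w' (t' : R), [/\ edge u' w', col w' = (col u').+1,
      odd (col u' + row u') = odd (col v + row v), 0 <= t' <= 1
      & edge_point u w t = edge_point u' w' t'].
  move=> uw par t01; have [cw|cw] := eqVneq (col w) (col u).+1.
    by exists u, w, t.
  exists w, u, (1 - t); rewrite edge_sym uw -edge_pointC.
  by move: uw; rewrite grid_edgeE => uw; split=> //; [lia|lia|lra].
move=> [u [w [t [/connect_parity par uw t01 ->]]]].
have [/eqP->|uw'] := orP uw; last exact: orient.
have [c /andP[cm uc] _] := neighbour_toward _ _ _ m_gt1 (col_lt u) (col_lt u).
have [r /andP[rn ur] _] := neighbour_toward _ _ _ n_gt1 (row_lt u) (row_lt u).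
have [w' [wc wr]] := grid_vertexP _ _ cm rn.
rewrite edge_point_id -(edge_point0 u w'); apply: orient => //.
  by rewrite grid_edgeE wc wr uc ur.
by rewrite lexx ler01.
Qed.

Lemma compl01 {t : R} : 0 <= t <= 1 -> 0 <= 1 - t <= 1.
Proof. by lra. Qed.

(* The lemmas below are named after the ends through which the route leaves the
   first edge and enters the second, when u, u' are the left ends: through both
   left ends, both right ends, the facing ends (inner) or the far ends (outer)
   of edges drawn in this order. *)
Section Routes.
Context {u w u' w' : grid} {s t : R}.
Hypotheses (uw : edge u w) (uw' : edge u' w').
Hypothesis par : odd (col u + row u) = odd (col u' + row u').
Hypotheses (s01 : 0 <= s <= 1) (t01 : 0 <= t <= 1).

Let par_w : odd (col w + row w) = odd (col u + row u).
Proof. by move: uw; rewrite grid_edgeE; lia. Qed.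

Let par_w' : odd (col w' + row w') = odd (col u' + row u').
Proof. by move: uw'; rewrite grid_edgeE; lia. Qed.

Let uw_sym : edge w u. Proof. by rewrite edge_sym. Qed.

Let uw_sym' : edge w' u'. Proof. by rewrite edge_sym. Qed.

Lemma grid_dist_le_left D (b : R) : within D u u' -> s + t + D%:R <= b ->
  (graph_dist (edge_point u w s) (edge_point u' w' t) <= b%:E)%E.
Proof.
move=> uu' b_ge; have [l l_walk lD] := walk_length_grid _ _ _ par uu'.
by apply: graph_dist_le (walk_length_between uw uw' s01 t01 l_walk) _; lra.
Qed.

Lemma grid_dist_le_right D (b : R) :
  within D w w' -> (1 - s) + (1 - t) + D%:R <= b ->
  (graph_dist (edge_point u w s) (edge_point u' w' t) <= b%:E)%E.
Proof.
have s01' := compl01 s01.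
have t01' := compl01 t01.
move=> ww' b_ge; have [|l l_walk lD] := walk_length_grid _ _ _ _ ww'.
  by rewrite par_w par_w'.
rewrite (edge_pointC u) (edge_pointC u').
by apply: graph_dist_le (walk_length_between uw_sym uw_sym' s01' t01' l_walk) _;
  lra.
Qed.

Lemma grid_dist_le_inner D (b : R) :
  within D w u' -> (1 - s) + t + D%:R <= b ->
  (graph_dist (edge_point u w s) (edge_point u' w' t) <= b%:E)%E.
Proof.
have s01' := compl01 s01.
move=> wu' b_ge; have [|l l_walk lD] := walk_length_grid _ _ _ _ wu'.
  by rewrite par_w.
rewrite (edge_pointC u).
by apply: graph_dist_le (walk_length_between uw_sym uw' s01' t01 l_walk) _; lra.
Qed.

Lemma grid_dist_le_outer D (b : R) :
  within D u w' -> s + (1 - t) + D%:R <= b ->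
  (graph_dist (edge_point u w s) (edge_point u' w' t) <= b%:E)%E.
Proof.
have t01' := compl01 t01.
move=> uw'_near b_ge; have [|l l_walk lD] := walk_length_grid _ _ _ _ uw'_near.
  by rewrite par_w'.
rewrite (edge_pointC u').
by apply: graph_dist_le (walk_length_between uw uw_sym' s01 t01' l_walk) _; lra.
Qed.

End Routes.

(* Columns a, a' and rows b, b' are those of the left ends of two edges, c and
   c' are the rows of the right ends. If the rows b and b' are the extreme ones
   of a square grid, then the right ends are closer by 2, and parity keeps
   a and a' from being extreme as well. *)
Lemma two_routes_budget a a' b b' c c' : (2 < m)%N ->
  (a.+1 < m)%N -> (a'.+1 < m)%N -> (b < m)%N -> (b' < m)%N ->
  (c < m)%N -> (c' < m)%N -> odd (a + b) = odd (a' + b') ->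
  c = b.+1 \/ b = c.+1 -> c' = b'.+1 \/ b' = c'.+1 ->
  exists D D', [/\ (D + D' + 4 = m + m)%N,
    (a <= a' + D)%N /\ (a' <= a + D)%N, (b <= b' + D)%N /\ (b' <= b + D)%N,
    (a <= a' + D')%N /\ (a' <= a + D')%N
    & (c <= c' + D')%N /\ (c' <= c + D')%N].
Proof.
move=> m_gt2 am am' bm bm' cm cm' par.
have [e|] := ltnP (b' + (m - 2)) b.
  have ee : b = m.-1 /\ b' = 0%N by lia.
  by move=> [] ? [] ?; exists (m - 1)%N, (m - 3)%N; split; lia.
have [e _|] := ltnP (b + (m - 2)) b'.
  have ee : b' = m.-1 /\ b = 0%N by lia.
  by move=> [] ? [] ?; exists (m - 1)%N, (m - 3)%N; split; lia.
have [e _ _|] := ltnP (c' + (m - 2)) c.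
  have ee : c = m.-1 /\ c' = 0%N by lia.
  by move=> [] ? [] ?; exists (m - 3)%N, (m - 1)%N; split; lia.
have [e _ _ _|? ? ? ?] := ltnP (c + (m - 2)) c'.
  have ee : c' = m.-1 /\ c = 0%N by lia.
  by move=> [] ? [] ?; exists (m - 3)%N, (m - 1)%N; split; lia.
by move=> _ _; exists (m - 2)%N, (m - 2)%N; split; lia.
Qed.

(** The routes through both left ends and through both right ends have total length at most
    [2 + D + D' = 2 (m - 1)], so one of them is short enough. *)
Lemma grid_diam v p q : (2 < m)%N -> (n <= m)%N -> component v p ->
  component v q -> (graph_dist p q <= (m%:R - 1)%:E)%E.
Proof.
move=> m_gt2 nm /component_gridP [u [w [s [uw cw pu s01 ->]]]].
move=> /component_gridP [u' [w' [t [uw' cw' pu' t01 ->]]]].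
have par : odd (col u + row u) = odd (col u' + row u') by rewrite pu pu'.
have [|||||||||D [D' [DD' [c1 c2] [r1 r2] [c1' c2'] [r1' r2']]]] :=
  two_routes_budget (col u) (col u') (row u) (row u') (row w) (row w') m_gt2.
- by rewrite -cw col_lt.
- by rewrite -cw' col_lt.
- exact: leq_trans (row_lt u) nm.
- exact: leq_trans (row_lt u') nm.
- exact: leq_trans (row_lt w) nm.
- exact: leq_trans (row_lt w') nm.
- exact: par.
- by move: uw; rewrite grid_edgeE; lia.
- by move: uw'; rewrite grid_edgeE; lia.
have {}DD' : D%:R + D'%:R + 4 = m%:R + m%:R :> R by rewrite -!natrD DD'.
have [st|st] := leP (s + t + D%:R) (m%:R - 1).
  by apply: (grid_dist_le_left uw uw' par s01 t01 D); [exact/and4P|].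
apply: (grid_dist_le_right uw uw' par s01 t01 D'); last lra.
by apply/and4P; rewrite cw cw'; split.
Qed.

Lemma col_edge_point u w (t : R) : col w = (col u).+1 ->
  extend colR (edge_point u w t) = (col u)%:R + t.
Proof. by move=> cw; rewrite extend_edge_point /colR cw -natr1; ring. Qed.

Lemma grid_fiber_diam v p q : (2 < n)%N -> component v p -> component v q ->
  extend colR p = extend colR q -> (graph_dist p q <= (n%:R - 1)%:E)%E.
Proof.
move=> n_gt2 /component_gridP [u [w [s [uw cw pu s01 ->]]]].
move=> /component_gridP [u' [w' [t [uw' cw' pu' t01 ->]]]].
rewrite !col_edge_point // => st.
have par : odd (col u + row u) = odd (col u' + row u') by rewrite pu pu'.
have [ru ru'] := (row_lt u, row_lt u'); have [rw rw'] := (row_lt w, row_lt w').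
have near1 : (col u <= (col u').+1)%N by rewrite -(ler_nat R) -natr1; lra.
have near2 : (col u' <= (col u).+1)%N by rewrite -(ler_nat R) -natr1; lra.
have uw_row : row w = (row u).+1 \/ row u = (row w).+1.
  by move: uw; rewrite grid_edgeE; lia.
have uw_row' : row w' = (row u').+1 \/ row u' = (row w').+1.
  by move: uw'; rewrite grid_edgeE; lia.
have n1 : n.-1%:R = n%:R - 1 :> R by rewrite -subn1 natrB //; lia.
(* Left ends in different columns force [s] and [t] to be 0 and 1: both points are then vertices of
   one column. *)
have [cu|cu|cu] := ltngtP (col u) (col u').
- have e : col u' = (col u).+1 by lia.
  move: st; rewrite e -natr1 => st.
  apply: (grid_dist_le_inner uw uw' par s01 t01 n.-1); last lra.
  by clear uw uw' s01 t01 pu pu' par st; apply/and4P; split; lia.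
- have e : col u = (col u').+1 by lia.
  move: st; rewrite e -natr1 => st.
  apply: (grid_dist_le_outer uw uw' par s01 t01 n.-1); last lra.
  by clear uw uw' s01 t01 pu pu' par st; apply/and4P; split; lia.
have {}st : s = t by move: st; rewrite cu; lra.
have n2 : n.-2%:R = n%:R - 2 :> R by rewrite -subn2 natrB.
(* As [s = t], an inner route costs [1 + D]. If the left ends, or below the right ends, lie in
   opposite extreme rows, then [w] and [u'] are within [n - 2]. *)
have [/andP[? ?]|/nandP uu'] :=
    boolP ((row u <= row u' + n.-2) && (row u' <= row u + n.-2))%N; last first.
  apply: (grid_dist_le_inner uw uw' par s01 t01 n.-2); last lra.
  by clear uw uw' s01 t01 pu pu' par st; apply/and4P; split; lia.
have [/andP[? ?]|/nandP ww'] :=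
    boolP ((row w <= row w' + n.-2) && (row w' <= row w + n.-2))%N; last first.
  apply: (grid_dist_le_inner uw uw' par s01 t01 n.-2); last lra.
  by clear uw uw' s01 t01 pu pu' par st; apply/and4P; split; lia.
(* Now all gaps are at most [n - 2], and leaving both edges through the nearer ends costs at most
   1. *)
have [s2|s2] := leP s (1 / 2).
  apply: (grid_dist_le_left uw uw' par s01 t01 n.-2); last lra.
  by clear uw uw' s01 t01 pu pu' par st; apply/and4P; split; lia.
apply: (grid_dist_le_right uw uw' par s01 t01 n.-2); last lra.
by clear uw uw' s01 t01 pu pu' par st; apply/and4P; split; lia.
Qed.

Lemma grid_dist_le_col v p q : (2 < n)%N -> component v p -> component v q ->
  (graph_dist p q <= (Num.max (`|extend colR p - extend colR q| + (n%:R - 1))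
                              (2 * (n%:R - 1)))%:E)%E.
Proof.
move=> n_gt2 /component_gridP [u [w [s [uw cw pu s01 ->]]]].
move=> /component_gridP [u' [w' [t [uw' cw' pu' t01 ->]]]].
rewrite !col_edge_point //.
have par : odd (col u + row u) = odd (col u' + row u') by rewrite pu pu'.
(* Left ends and right ends have the same column gap and row gaps at most [n - 1], so [D] serves
   both routes; the better one adds at most 1. *)
pose D := maxn (maxn (col u - col u') (col u' - col u)) n.-1.
set b := Num.max _ _.
(* If [D] is the column gap, the column values differ by at least [D - 1], and [n - 1 >= 2] makes up
   the rest; if [D = n - 1], the second term of the maximum suffices. *)
have Db : 1 + D%:R <= b.
  have n3 : 3 <= n%:R :> R by rewrite (ler_nat R 3).
  rewrite /b le_max; have [Dn|[Dn|Dn]] : D = n.-1 \/ (D + col u' = col u)%N \/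
      (D + col u = col u')%N by rewrite /D; clear; lia.
  - apply/orP; right; rewrite Dn -subn1 natrB; last lia.
    by lra.
  - apply/orP; left; rewrite -Dn natrD.
    by apply: le_trans (lerD (ler_norm _) (lexx _)); lra.
  - apply/orP; left; rewrite -Dn natrD distrC.
    by apply: le_trans (lerD (ler_norm _) (lexx _)); lra.
have [D1 [D2 D3]] :
    (col u <= col u' + D)%N /\ (col u' <= col u + D)%N /\ (n.-1 <= D)%N.
  by rewrite /D; clear; lia.
have [ru ru'] := (row_lt u, row_lt u'); have [rw rw'] := (row_lt w, row_lt w').
have [st|st] := leP (s + t) 1.
  apply: (grid_dist_le_left uw uw' par s01 t01 D); last lra.
  clearbody D; clear uw uw' s01 t01 pu pu' par st Db.
  by apply/and4P; split; lia.
apply: (grid_dist_le_right uw uw' par s01 t01 D); last lra.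
clearbody D; clear uw uw' s01 t01 pu pu' par st Db.
by apply/and4P; split; lia.
Qed.

(** With two rows, parity determines the row from the column, so a component is a path with the
    column value as arc length. *)
Lemma ladder_dist_le v p q : n = 2%N -> component v p -> component v q ->
  (graph_dist p q <= `|extend colR p - extend colR q|%:E)%E.
Proof.
move=> n2 /component_gridP [u [w [s [uw cw pu s01 ->]]]].
move=> /component_gridP [u' [w' [t [uw' cw' pu' t01 ->]]]].
rewrite !col_edge_point //.
have par : odd (col u + row u) = odd (col u' + row u') by rewrite pu pu'.
have [ru ru'] := (row_lt u, row_lt u'); have [rw rw'] := (row_lt w, row_lt w').
have uw_row : row w = (row u).+1 \/ row u = (row w).+1.
  by move: uw; rewrite grid_edgeE; lia.
have uw_row' : row w' = (row u').+1 \/ row u' = (row w').+1.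
  by move: uw'; rewrite grid_edgeE; lia.
have [cu|cu|cu] := ltngtP (col u) (col u').
- rewrite distrC; apply: (grid_dist_le_inner uw uw' par s01 t01 (col u' - col w)).
    clear uw uw' s01 t01 pu pu'; rewrite /within ?cw ?cw'; apply/and4P.
    by split; lia.
  rewrite cw natrB // -natr1.
  by apply: le_trans (ler_norm _); lra.
- apply: (grid_dist_le_outer uw uw' par s01 t01 (col u - col w')).
    clear uw uw' s01 t01 pu pu'; rewrite /within ?cw ?cw'; apply/and4P.
    by split; lia.
  rewrite cw' natrB // -natr1.
  by apply: le_trans (ler_norm _); lra.
have uu' : u' = u by apply: grid_inj; lia.
have ww' : w' = w.
  apply: grid_inj; first by rewrite cw cw' cu.
  by move: uw_row uw_row'; rewrite uu'; clear -n2 rw rw' ru; lia.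
rewrite uu' ww' (addrC _ s) addrKA.
exact: graph_dist_le (walk_length_edge uw s01 t01) _.
Qed.

End Grid.

(** * Bounds on the hyperbolicity constant of the product *)

Section Hyperbolicity.
Context {R : realType} {m n : nat}.
Notation grid := (direct_product (path_graph m) (path_graph n)).
Notation delta := (hyperbolicity R grid).

Lemma hyperbolicity_grid_ge r : (r.*2 < m)%N -> (r.+1 < n)%N ->
  (r%:R%:E <= delta)%E.
Proof.
move=> rm rn.
have path_exists (h : nat -> nat) : (forall k, h k < n)%N ->
    exists v : nat -> grid, forall k, (k <= r.*2)%N -> col (v k) = k /\ row (v k) = h k.
  (* Capping the column at [2r] keeps the sequence in the grid for every index. *)
  move=> hn; have im k : (minn k r.*2 < m)%N by lia.
  exists (fun k => (Ordinal (im k), Ordinal (hn k))) => k kr.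
  by rewrite /col /row /=; split=> //; exact/minn_idPl.
(* Both profiles are in row 1 at 0 and at [2r]; [peak] reaches row [r + 1] at [k = r], while
   [zigzag] stays in rows 0 and 1. *)
pose peak k := if (k <= r)%N then k.+1 else (r.*2.+1 - k)%N.
pose zigzag k : nat := ~~ odd k.
have [|v vP] := path_exists peak; first by rewrite /peak => k; case: ifP; lia.
have [|w wP] := path_exists zigzag; first by rewrite /zigzag => k; case: odd; lia.
have vw0 : v 0%N = w 0%N.
  have [? vr] := vP 0%N isT; have [? wr] := wP 0%N isT.
  by apply: grid_inj; rewrite ?vr ?wr /peak /zigzag /=; lia.
have vwr : v r.*2 = w r.*2.
  have [? vr] := vP r.*2 (leqnn _); have [? wr] := wP r.*2 (leqnn _).
  apply: grid_inj; first by lia.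
  by rewrite vr wr /peak /zigzag odd_double; case: ifP; lia.
have v_edge k : (k < r.*2)%N -> edge (v k) (v k.+1).
  move=> kr; have [vc vr] := vP k (ltnW kr); have [vc' vr'] := vP k.+1 kr.
  by rewrite grid_edgeE vc vr vc' vr' /peak; case: ifP; case: ifP; lia.
have w_edge k : (k < r.*2)%N -> edge (w k) (w k.+1).
  move=> kr; have [wc wr] := wP k (ltnW kr); have [wc' wr'] := wP k.+1 kr.
  by rewrite grid_edgeE wc wr wc' wr' /zigzag /=; case: odd; lia.
(* Both paths advance one column per step, so the column function certifies both as geodesics. *)
have v_col k : (k <= r.*2)%N -> colR (v k) = 0 + k%:R :> R.
  by move=> /vP [vc _]; rewrite /colR vc add0r.
have w_col k : (k <= r.*2)%N -> colR (w k) = 0 + k%:R :> R.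
  by move=> /wP [wc _]; rewrite /colR wc add0r.
have gv := polyline_geodesic _ _ _ _ v_edge colR_lipschitz v_col.
have gw := polyline_geodesic _ _ _ _ w_edge colR_lipschitz w_col.
rewrite -vw0 -vwr in gw.
apply: (@le_trans _ _
  (space_hyperbolicity (@graph_dist R grid) (component (v 0%N)))); last first.
  by apply: ereal_sup_ubound; exists (v 0%N).
have r2 : (r <= r.*2)%N by lia.
apply: (space_hyperbolicity_ge_bigon (p := graph_vertex (v r)) _ gv gw).
- case: gw => L [g [L0 [_ <-] gA _ _]]; apply: gA.
  by rewrite L0 lexx.
- exact: graph_dist0.
- by exists r%:R; rewrite /= ?polyline_nat // ler0n ler_nat.
move=> q [t t01 <-].
apply: le_trans (extend_lipschitz rowR_lipschitz _ _); rewrite lee_fin.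
have w1 k : (k <= r.*2)%N -> rowR (w k) <= 1 :> R.
  by move=> /wP [_ wr]; rewrite /rowR wr /zigzag; case: odd; rewrite ?ler01.
have := extend_polyline_le _ _ _ _ w1 t t01.
rewrite extend_graph_vertex /rowR (vP r r2).2 /peak leqnn -natr1 => q1.
by apply: le_trans (ler_norm _); lra.
Qed.

Hypotheses (n_gt1 : (1 < n)%N) (nm : (n <= m)%N).

Lemma hyperbolicity_le (K : R) :
  (forall v : grid, space_hyperbolicity (@graph_dist R grid) (component v) <= K%:E)%E ->
  (delta <= K%:E)%E.
Proof. by move=> le_K; apply: ge_ereal_sup => _ [v _ <-]. Qed.

Lemma hyperbolicity_grid_le_half_width : (2 < m)%N ->
  (delta <= ((m%:R - 1) / 2)%:E)%E.
Proof.
move=> m_gt2; apply: hyperbolicity_le => v.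
apply: space_hyperbolicity_le_half_diam.
  by rewrite subr_ge0 ler1n; lia.
by move=> p q; apply: grid_diam => //; lia.
Qed.

Lemma hyperbolicity_grid_le_height : (2 < n)%N -> (delta <= (n%:R - 1)%:E)%E.
Proof.
move=> n_gt2; apply: hyperbolicity_le => v.
apply: (space_hyperbolicity_le_fiber (extend_lipschitz colR_lipschitz)).
- by rewrite subr_ge0 ler1n; lia.
- by move=> p q; apply: grid_fiber_diam => //; lia.
- by move=> p q; apply: grid_dist_le_col => //; lia.
Qed.

Lemma hyperbolicity_ladder_le : n = 2%N -> (delta <= 0%:E)%E.
Proof.
move=> n2; apply: hyperbolicity_le => v.
have dist (p q : {ffun grid -> R}) : component v p -> component v q ->
    (graph_dist p q <= `|extend colR p - extend colR q|%:E)%E.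
  by move=> vp vq; apply: ladder_dist_le vp vq => //; lia.
apply: (space_hyperbolicity_le_fiber (extend_lipschitz colR_lipschitz)) => //.
- by move=> p q vp vq pq; have := dist p q vp vq; rewrite pq subrr normr0.
- move=> p q vp vq; apply: le_trans (dist p q vp vq) _.
  by rewrite lee_fin le_max addr0 lexx.
Qed.

End Hyperbolicity.

Theorem theorem3p5 (R : realType) (m n : nat) (n_ge2 : (2 <= n)%N)
    (m_ge_n : (n <= m)%N) :
  let delta := hyperbolicity R (direct_product (path_graph m) (path_graph n)) in
  [/\ n = 2%N -> delta = 0%:E,
      (3 <= n)%N ->
        ((Num.min (m%:R / 2) (n%:R - 1) - 1)%:E <= delta)%E /\
        (delta <= (Num.min (m%:R / 2) n%:R - 1 / 2)%:E)%E
    & (m + 3 <= 2 * n)%N -> odd m -> delta = ((m%:R - 1) / 2)%:E].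
Proof.
move=> delta; split=> [n2|n3|mn m_odd].
- apply/le_anti/andP; split; first exact: hyperbolicity_ladder_le.
  (* The case [r = 0] of the lower bound is nonnegativity. *)
  by apply: (@hyperbolicity_grid_ge R m n 0); lia.
- split.
    (* The largest admissible [r] is the smaller of [n - 2] and the integer part of
       [(m - 1) / 2]. *)
    have [mn|nm] := leP m (n.-2.*2).
      have := @hyperbolicity_grid_ge R m n m.-1./2 ltac:(lia) ltac:(lia).
      apply: le_trans; rewrite lee_fin lerBlDr ge_min; apply/orP; left.
      rewrite ler_pdivrMr // natr1 -natrM ler_nat; lia.
    have := @hyperbolicity_grid_ge R m n n.-2 ltac:(lia) ltac:(lia).
    apply: le_trans; rewrite lee_fin lerBlDr ge_min; apply/orP; right.
    by rewrite lerBlDr !natr1 ler_nat; lia.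
  have le_m := hyperbolicity_grid_le_half_width (R := R) n_ge2 m_ge_n ltac:(lia).
  have le_n := hyperbolicity_grid_le_height (R := R) n_ge2 m_ge_n n3.
  have [_|_] := leP (m%:R / 2) (n%:R : R).
  + by apply: le_trans le_m _; rewrite lee_fin; lra.
  + by apply: le_trans le_n _; rewrite lee_fin; lra.
- apply/le_anti/andP; split.
    by apply: hyperbolicity_grid_le_half_width => //; lia.
  (* For odd [m], [r = (m - 1) / 2] is an integer, and [m + 3 <= 2n] gives [r + 2 <= n]; the lower
     bound then meets the upper one. *)
  have mE : m = (m./2.*2).+1 by lia.
  have := @hyperbolicity_grid_ge R m n m./2 ltac:(lia) ltac:(lia).
  apply: le_trans; rewrite lee_fin {1}mE -natr1 addrK -muln2 natrM.
  by rewrite mulfK ?pnatr_eq0.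
Qed.
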